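(* Let $X$ be an infinite-dimensional Banach space with the super alternative Daugavet property and let $Z$ be a separable subspace of $X$. Then there is a separable (closed) subspace $W$ of $X$ which has the super alternative Daugavet property and contains $Z$.
   Context: Banach spaces are non-zero and over $\mathbb{K}$ ($\mathbb{R}$ or $\mathbb{C}$); $B_X$, $S_X$ denote the closed unit ball and the unit sphere of $X$; $\mathbb{T}=\{\theta\in\mathbb{K}:|\theta|=1\}$. $X$ has the super alternative Daugavet property (super ADP) if for every $x\in S_X$ and every non-empty relatively weakly open subset $W$ of $B_X$ with $W\cap S_X\neq\emptyset$, one has $\sup_{y\in W}\max_{\theta\in\mathbb{T}}\|x+\theta y\|=2$. *)

(* Defs.v *)
From HB Require Import structures.
From mathcomp Require Import all_boot all_order all_algebra complex.
From mathcomp Require Import all_classical all_reals all_analysis.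

Set Implicit Arguments.
Unset Strict Implicit.
Unset Printing Implicit Defensive.

Import Order.TTheory GRing.Theory Num.Theory.
Import numFieldNormedType.Exports.

Local Open Scope classical_set_scope.
Local Open Scope ring_scope.

Definition separable (T : topologicalType) : Prop :=
  exists2 D : set T, countable D & dense D.

Definition infinite_dimensional (K : fieldType) (X : lmodType K) : Prop :=
  ~ exists (n : nat) (e : 'I_n -> X),
      forall x : X, exists a : 'I_n -> K, x = \sum_(i < n) a i *: e i.

Section linear_subspace.
Context (K : numFieldType) (X : normedModType K) (Y : submodClosed X).

(* The linear subspace Y as a normed space in its own right; Y need not be
   topologically closed. *)
Definition subspace_type : Type := {x : X | x \in Y}.

HB.instance Definition _ := SubType.on subspace_type.
HB.instance Definition _ := [Choice of subspace_type by <:].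
HB.instance Definition _ := [SubChoice_isSubLmodule of subspace_type by <:].

Let norm_sub (x : subspace_type) : K := `|val x|.

Let norm_sub_triangle x y : norm_sub (x + y) <= norm_sub x + norm_sub y.
Proof. by rewrite /norm_sub raddfD ler_normD. Qed.

Let norm_subZ (l : K) x : norm_sub (l *: x) = `|l| * norm_sub x.
Proof. by rewrite /norm_sub linearZ normrZ. Qed.

Let norm_sub_eq0 x : norm_sub x = 0 -> x = 0.
Proof. by move=> /normr0_eq0 x0; apply: val_inj; rewrite x0 raddf0. Qed.

HB.instance Definition _ := Lmodule_isNormed.Build K subspace_type
  norm_sub_triangle norm_subZ norm_sub_eq0.

End linear_subspace.

Section super_ADP.
Context (K : numFieldType) (X : normedModType K).

Definition dual : Type := {f : {scalar X} | continuous (f : X -> K)}.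

(* The weak topology of X is the coarsest one making each f in the dual
   continuous. *)
Definition weak : topologicalType :=
  @sup_topology X dual
    (fun f => Topological.class (initial_topology (proj1_sig f : X -> K))).

Definition unit_ball : set X := [set x | `|x| <= 1].
Definition unit_sphere : set X := [set x | `|x| = 1].
Definition torus : set K := [set t | `|t| = 1].

Definition rel_weakly_open (W : set X) : Prop :=
  exists2 U : set weak, open U & W = U `&` unit_ball.

Definition is_max (A : set K) (m : K) : Prop := A m /\ ubound A m.

(* Norms take values in K.  When K is the field of complex numbers, its order
   relates only numbers with equal imaginary parts, so maxima and suprema of
   nonempty sets of norms are the ones computed in the real numbers. *)
Definition super_ADP : Prop :=
  forall x : X, unit_sphere x ->
  forall W : set X, W !=set0 -> rel_weakly_open W ->
    W `&` unit_sphere !=set0 ->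
    supremums [set m | exists2 y, W y &
                 is_max [set `|x + t *: y| | t in torus] m] 2.

End super_ADP.

Arguments super_ADP {K} X.

(* Main.v *)
(* Unit vectors u and v and k being given, the super ADP says that v lies in
   the weak closure of the set of z in the unit ball with
   |u + t z| > 2 - 1/(k+1) for some unimodular t.  By Kaplansky's theorem
   (countable tightness of the weak topology, a consequence of the weak-*
   compactness of the dual ball) a countable subset of it is enough.  Closing a
   countable dense subset of Z under addition, multiplication by a countable
   dense set of scalars and these countable sets, for u and v normalized
   elements of the set, yields a countable S, and W is the closure of S.  By
   the Hahn-Banach theorem, weak closures of subsets of W may be computed in X
   or in W, and density of S carries the property over to all unit vectors
   of W. *)
Require Import Defs.
From HB Require Import structures.
From mathcomp Require Import all_boot all_order all_algebra complex.
From mathcomp Require Import all_classical all_reals all_analysis.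
From mathcomp Require Import finmap ring lra.

Set Implicit Arguments.
Unset Strict Implicit.
Unset Printing Implicit Defensive.

Import Order.TTheory GRing.Theory Num.Theory.
Import numFieldNormedType.Exports.

Local Open Scope classical_set_scope.
Local Open Scope ring_scope.

(** * The Hahn-Banach theorem *)

Section sublinear.
Context (R : realType) (V : lmodType R).

(** Homogeneity is asked only as an inequality, the form that passes to infima; applying it also to
    the inverse of [r] gives equality. *)
Definition sublinear (p : V -> R) : Prop :=
  (forall x y, p (x + y) <= p x + p y) /\
  (forall r x, 0 < r -> p (r *: x) <= r * p x).

Lemma sublinearZ p r x : sublinear p -> 0 < r -> p (r *: x) = r * p x.
Proof.
move=> [_ pZ] r0; apply/le_anti; rewrite pZ//= -ler_pdivlMl//.
have := pZ r^-1 (r *: x); rewrite invr_gt0 => /(_ r0).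
by rewrite scalerA mulVf ?gt_eqF// scale1r.
Qed.

Lemma sublinear0 p : sublinear p -> p 0 = 0.
Proof.
move=> sp; have := sublinearZ 0 sp (ltr0n R 2).
by rewrite scaler0; lra.
Qed.

Lemma sublinear_geN p x : sublinear p -> - p (- x) <= p x.
Proof.
move=> sp; have := sp.1 x (- x); rewrite subrr sublinear0//.
by lra.
Qed.

(** The minorant [l] keeps each infimum finite, and the last two conditions let sums and multiples
    be controlled by a single member of [Q]. Chains and the two families [h] below are of this
    kind. *)
Lemma sublinear_inf (Q : set (V -> R)) (l : V -> R) : Q !=set0 ->
  (forall q x, Q q -> l x <= q x) ->
  (forall q1 q2 x y, Q q1 -> Q q2 ->
     exists2 q, Q q & q (x + y) <= q1 x + q2 y) ->
  (forall q r x, Q q -> 0 < r -> exists2 q', Q q' & q' (r *: x) <= r * q x) ->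
  sublinear (fun x => inf [set q x | q in Q]).
Proof.
move=> [q0 Qq0] lQ QD QZ.
have bnd x : has_lbound [set q x | q in Q].
  by exists (l x) => _ [q Qq <-]; exact: lQ.
have ne x : [set q x | q in Q] !=set0 by exists (q0 x), q0.
have infle q x : Q q -> inf [set q x | q in Q] <= q x.
  by move=> Qq; apply: ge_inf => //; exists q.
split=> [x y|r x r0].
  rewrite -lerBlDr; apply: lb_le_inf => // _ [q1 Qq1 <-].
  rewrite lerBlDr -lerBlDl; apply: lb_le_inf => // _ [q2 Qq2 <-].
  rewrite lerBlDl; have [q Qq qle] := QD _ _ x y Qq1 Qq2.
  exact: le_trans (infle _ _ Qq) qle.
rewrite -ler_pdivrMl//; apply: lb_le_inf => // _ [q Qq <-].
rewrite ler_pdivrMl//; have [q' Qq' qle] := QZ _ _ x Qq r0.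
exact: le_trans (infle _ _ Qq') qle.
Qed.

(** Zorn's lemma for the reversed pointwise order. A nonempty chain is bounded by its pointwise
    infimum, finite because a sublinear [s] below [p] satisfies [- p (- x) <= - s (- x) <= s x]. *)
Lemma minimal_sublinear p : sublinear p ->
  exists q, [/\ sublinear q, forall x, q x <= p x &
    forall q', sublinear q' -> (forall x, q' x <= q x) -> q' = q].
Proof.
move=> sp.
pose P q := sublinear q /\ forall x, q x <= p x.
pose T := {q | P q}.
pose le (s t : T) := `[< forall x, sval t x <= sval s x >].
have [|||A totA|[q [sq qp]] qmin] := @Zorn T le.
- by move=> t; apply/asboolP.
- move=> r s t /asboolP rs /asboolP st; apply/asboolP => x.
  exact: le_trans (st x) (rs x).
- move=> [s Hs] [t Ht] /asboolP /= st /asboolP /= ts; apply: eq_exist.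
  by apply/funext => x; apply/le_anti; rewrite st ts.
(* The empty chain is bounded by [p] itself. *)
- have [[t0 At0]|A0] := pselect (exists t, A t); last first.
    have Pp : P p by [].
    by exists (exist P p Pp) => s As; exfalso; apply: A0; exists s.
  pose Q := [set sval s | s in A].
  have lQ q x : Q q -> - p (- x) <= q x.
    move=> [[s [ss sp']] _ <-] /=.
    by rewrite (le_trans _ (sublinear_geN x ss))// lerN2.
  have sI : sublinear (fun x => inf [set q x | q in Q]).
    apply: sublinear_inf (lQ) _ _; first by exists (sval t0), t0.
      move=> _ _ x y [s As <-] [t At <-].
      have [/asboolP st|/asboolP ts] := totA _ _ As At.
        exists (sval t); first by exists t.
        by rewrite (le_trans ((svalP t).1.1 x y))// lerD2r.
      exists (sval s); first by exists s.
      by rewrite (le_trans ((svalP s).1.1 x y))// lerD2l.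
    move=> _ r x [s As <-] r0; exists (sval s); first by exists s.
    exact: (svalP s).1.2.
  have infle s x : A s -> inf [set q x | q in Q] <= sval s x.
    move=> As; apply: ge_inf; last by exists (sval s) => //; exists s.
    by exists (- p (- x)) => _ [q Qq <-]; exact: lQ.
  have Ip x : inf [set q x | q in Q] <= p x.
    exact: le_trans (infle _ _ At0) ((svalP t0).2 x).
  exists (exist P _ (conj sI Ip)) => s As; apply/asboolP => x /=.
  exact: infle.
- exists q; split=> // q' sq' q'q.
  have q'p x : q' x <= p x := le_trans (q'q x) (qp x).
  have : exist P q' (conj sq' q'p) = exist P q (conj sq qp).
    by apply: qmin; apply/asboolP.
  by move/(congr1 sval).
Qed.

(* A minimal sublinear functional q dominates, for every a, the sublinear
   functional x |-> inf_{t >= 0} (q (x + t a) - t q a), hence equals it. *)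
Lemma sublinear_linear_minorant p : sublinear p ->
  exists2 g : V -> R, scalar g & forall x, g x <= p x.
Proof.
move=> /minimal_sublinear[q [sq qp qmin]].
have qZ0 r x : 0 <= r -> q (r *: x) = r * q x.
  rewrite le_eqVlt => /predU1P[<-|]; last exact: sublinearZ.
  by rewrite scale0r mul0r sublinear0.
have qD x a : q (x + a) = q x + q a.
  pose h t x := q (x + t *: a) - t * q a.
  pose Q := [set h t | t in [set t | 0 <= t]].
  have lQ f z : Q f -> - q (- z) <= f z.
    move=> [t /= t0 <-]; rewrite /h; have := sq.1 (z + t *: a) (- z).
    by rewrite addrAC subrr add0r qZ0//; lra.
  have infle t z : 0 <= t -> inf [set f z | f in Q] <= h t z.
    move=> t0; apply: ge_inf; last by exists (h t) => //; exists t.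
    by exists (- q (- z)) => _ [f Qf <-]; exact: lQ.
  have sI : sublinear (fun x => inf [set f x | f in Q]).
    apply: sublinear_inf (lQ) _ _; first by exists (h 0), 0 => /=.
      move=> _ _ y z [s /= s0 <-] [t /= t0 <-]; exists (h (s + t)).
        by exists (s + t) => //=; rewrite addr_ge0.
      have := sq.1 (y + s *: a) (z + t *: a).
      by rewrite /h addrACA -scalerDl; lra.
    move=> _ r y [t /= t0 <-] r0; exists (h (r * t)).
      by exists (r * t) => //=; rewrite mulr_ge0// ltW.
    by rewrite /h -scalerA -scalerDr sublinearZ//; lra.
  have qE := qmin _ sI.
  have {}qE : (fun x => inf [set f x | f in Q]) = q.
    apply: qE => y; rewrite (le_trans (infle 0 y _))// /h.
    by rewrite scale0r mul0r addr0 subr0.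
  (* At [t = 1] minimality gives superadditivity, the missing half of additivity. *)
  have : q x <= h 1 x by rewrite -[X in X x <= _]qE; exact: infle.
  rewrite /h scale1r mul1r => qle; apply/le_anti; rewrite sq.1/=.
  by rewrite -lerBrDr.
have qN x : q (- x) = - q x.
  by apply/eqP; rewrite -addr_eq0 -qD addNr sublinear0.
exists q => // r x y; rewrite qD; congr (_ + _).
have [r0|r0] := leP 0 r; first exact: qZ0.
by rewrite -[r]opprK scaleNr qN qZ0 ?mulNr// oppr_ge0 ltW.
Qed.

(* The linear functional is a minorant of
   x |-> inf_y (p (x - j y) + f y). *)
Lemma hahn_banach (Y : lmodType R) (j : Y -> V) (f : Y -> R) (p : V -> R) :
  sublinear p -> linear j -> scalar f -> (forall y, f y <= p (j y)) ->
  exists g : V -> R,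
    [/\ scalar g, forall x, g x <= p x & forall y, g (j y) = f y].
Proof.
move=> sp lj lf fp.
have jD y z : j (y + z) = j y + j z by have := lj 1 y z; rewrite !scale1r.
have fD y z : f (y + z) = f y + f z by have := lf 1 y z; rewrite scale1r mul1r.
have j0 : j 0 = 0 by apply: (addrI (j 0)); rewrite -jD !addr0.
have f0 : f 0 = 0 by apply: (addrI (f 0)); rewrite -fD !addr0.
have jZ r y : j (r *: y) = r *: j y by have := lj r y 0; rewrite j0 !addr0.
have fZ r y : f (r *: y) = r * f y by have := lf r y 0; rewrite f0 !addr0.
have fN y : f (- y) = - f y by apply/eqP; rewrite -addr_eq0 -fD addNr f0.
have jN y : j (- y) = - j y by apply/eqP; rewrite -addr_eq0 -jD addNr j0.
pose h y x := p (x - j y) + f y.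
pose Q := range h.
have lQ q x : Q q -> - p (- x) <= q x.
  move=> [y _ <-]; rewrite /h; have := sp.1 (x - j y) (- x).
  by have := fp (- y); rewrite fN jN addrAC subrr add0r; lra.
have infle y x : inf [set q x | q in Q] <= h y x.
  apply: ge_inf; last by exists (h y) => //; exists y.
  by exists (- p (- x)) => _ [q Qq <-]; exact: lQ.
have sI : sublinear (fun x => inf [set q x | q in Q]).
  apply: sublinear_inf (lQ) _ _; first by exists (h 0), 0.
    move=> _ _ x z [y _ <-] [y' _ <-]; exists (h (y + y')).
      by exists (y + y').
    have := sp.1 (x - j y) (z - j y').
    by rewrite /h jD fD opprD addrACA; lra.
  move=> _ r x [y _ <-] r0; exists (h (r *: y)); first by exists (r *: y).
  by rewrite /h jZ fZ -scalerBr sublinearZ//; lra.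
have [g lg gle] := sublinear_linear_minorant sI.
have gD y z : g (y + z) = g y + g z by have := lg 1 y z; rewrite scale1r mul1r.
have g0 : g 0 = 0 by apply: (addrI (g 0)); rewrite -gD !addr0.
have gN x : g (- x) = - g x by apply/eqP; rewrite -addr_eq0 -gD addNr g0.
(* The member [h y] takes the value [f y] at [j y]. One inequality is enough: applied to [- y] it
   gives the reverse one by linearity. *)
have gj y : g (j y) <= f y.
  rewrite (le_trans (gle _))// (le_trans (infle y _))// /h.
  by rewrite subrr sublinear0// add0r.
exists g; split=> // [x|y].
  rewrite (le_trans (gle _))// (le_trans (infle 0 _))// /h.
  by rewrite j0 f0 subr0 addr0.
apply/le_anti; rewrite gj/=.
by have := gj (- y); rewrite jN gN fN lerN2.
Qed.

End sublinear.

(** * Extension of bounded functionals over the real and the complex field *)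

Section restriction_of_scalars.
Context (R : realType) (V : lmodType R[i]).

(** A new name for the carrier [V], so that its real scaling does not compete with the complex
    one. *)
Definition realification : Type := V.

HB.instance Definition _ := GRing.Zmodule.on realification.

Definition real_scale (r : R) (x : realification) : realification :=
  real_complex R r *: (x : V).

Let real_scaleA a b v : real_scale a (real_scale b v) = real_scale (a * b) v.
Proof. by rewrite /real_scale scalerA -rmorphM. Qed.

Let real_scale1 : left_id 1 real_scale.
Proof. by move=> v; rewrite /real_scale rmorph1 scale1r. Qed.

Let real_scaleDr : right_distributive real_scale +%R.
Proof. by move=> r x y; rewrite /real_scale scalerDr. Qed.

Let real_scaleDl v : {morph real_scale^~ v : a b / a + b}.
Proof. by move=> a b; rewrite /real_scale rmorphD scalerDl. Qed.

HB.instance Definition _ := GRing.Zmodule_isLmodule.Build R realification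
  real_scaleA real_scale1 real_scaleDr real_scaleDl.

End restriction_of_scalars.

Lemma scalar_extension_real (R : realType) (X : normedModType R)
    (Y : submodClosed X) (f : subspace_type Y -> R) (M : R) :
  scalar f -> (forall y, `|f y| <= M * `|y|) ->
  exists F : X -> R, [/\ scalar F, exists M', forall x, `|F x| <= M' * `|x| &
    forall y, F (val y) = f y].
Proof.
move=> lf fM.
have sp : sublinear (fun x : X => `|M| * `|x|).
  split=> [x y|r x r0]; first by rewrite -mulrDr ler_wpM2l// ler_normD.
  by rewrite normrZ gtr0_norm// mulrCA.
have lj : linear (val : subspace_type Y -> X) by move=> r x y; rewrite linearP.
have fp y : f y <= `|M| * `|val y|.
  rewrite (le_trans (ler_norm _))// (le_trans (fM y))//.
  by rewrite ler_wpM2r// ler_norm.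
have [g [lg gp gf]] := hahn_banach sp lj lf fp.
exists g; split=> //; exists `|M| => x; rewrite ler_norml gp andbT.
have g0 : g 0 = 0.
  by have := lg (-1) 0 0; rewrite scaler0 addr0 mulN1r addNr.
have gN : g (- x) = - g x.
  by have := lg (-1) x 0; rewrite scaleN1r g0 !addr0 mulN1r.
by rewrite lerNl -gN -(normrN x).
Qed.

(** The real part of [f] is extended to a real functional [g], and [F x = g x - i g (i x)] is the
    complex functional with real part [g]. *)
Lemma scalar_extension_complex (R : realType) (X : normedModType R[i])
    (Y : submodClosed X) (f : subspace_type Y -> R[i]) (M : R[i]) :
  0 <= M -> scalar f -> (forall y, `|f y| <= M * `|y|) ->
  exists F : X -> R[i],
    [/\ scalar F, exists M', forall x, `|F x| <= M' * `|x| &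
    forall y, F (val y) = f y].
Proof.
move=> M0 lf fM.
have CD (a b : R) : (a + b)%:C%C = a%:C%C + b%:C%C :> R[i] by exact: rmorphD.
have CM (a b : R) : (a * b)%:C%C = a%:C%C * b%:C%C :> R[i] by exact: rmorphM.
(* Norms of [X] lie in [R[i]]; [N] is the same norm with values in [R]. *)
pose N (x : X) : R := complex.Re `|x : X|.
have NE (x : X) : `|x| = real_complex R (N x).
  by rewrite RRe_real// normr_real.
have N_ge0 x : 0 <= N x by rewrite -ler0c -NE.
have ND (x y : X) : N (x + y) <= N x + N y.
  by rewrite -lecR CD -!NE ler_normD.
have NZ (r : R) (x : X) : 0 <= r -> N (r%:C%C *: x) = r * N x.
  move=> r0; apply: complexI; rewrite -NE normrZ NE CM; congr (_ * _).
  by rewrite ger0_norm// ler0c.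
pose m : R := complex.Re `|M|.
have m_ge0 : 0 <= m by rewrite -ler0c RRe_real// normr_real.
pose p (x : realification X) : R := m * N x.
have sp : sublinear p.
  split=> [x y|r x r0]; first by rewrite /p -mulrDr ler_wpM2l// ND.
  by rewrite /p [N _](NZ r x (ltW r0)) mulrCA.
pose j (y : realification (subspace_type Y)) : realification X :=
  val (y : subspace_type Y).
have lj : linear j by move=> r x y; rewrite /j linearP.
pose fr (y : realification (subspace_type Y)) : R := complex.Re (f y).
have lfr : scalar fr.
  move=> r x y; rewrite /fr.
  have -> : r *: x + y = real_complex R r *: (x : subspace_type Y) + y by [].
  rewrite lf.
  by case: (f x) (f y) => [a b] [c d] /=; rewrite mul0r subr0.
have Re_le (z : R[i]) : complex.Re z <= complex.Re `|z|.
  case: z => a b /=; rewrite (le_trans (ler_norm a))//.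
  by rewrite -sqrtr_sqr ler_wsqrtr// lerDl sqr_ge0.
have frp y : fr y <= p (j y).
  rewrite (le_trans (Re_le _))// -lecR RRe_real ?normr_real//.
  rewrite (le_trans (fM y))// /p CM -NE RRe_real ?normr_real//.
  by rewrite ler_wpM2r// ger0_norm.
have [g [lg gp gf]] := hahn_banach sp lj lfr frp.
have gD (x y : X) : g (x + y) = g x + g y.
  by have := lg 1 x y; rewrite scale1r mul1r.
have g0 : g (0 : X) = 0 by apply: (addrI (g 0)); rewrite -gD !addr0.
have gZ (r : R) (x : X) : g (r%:C%C *: x) = r * g x.
  by have := lg r x 0; rewrite !addr0 [g (0 : realification X)]g0 addr0.
have gN (x : X) : g (- x) = - g x.
  by apply/eqP; rewrite -addr_eq0 -gD addNr g0.
have gM x : `|g x| <= m * N x.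
  rewrite ler_norml [_ <= m * _]gp andbT lerNl -gN (le_trans (gp _))//.
  by rewrite /p /N normrN.
have i1 : `|'i%C : R[i]| = 1.
  by rewrite normc_def /= expr0n expr1n /= add0r sqrtr1.
have Ni (x : X) : N ('i%C *: x) = N x.
  by rewrite /N normrZ i1 mul1r.
exists (fun x => (g x +i* - g ('i%C *: x))%C); split.
- move=> [a b] x y.
  have gc (z : X) : g ((a +i* b)%C *: z) = a * g z + b * g ('i%C *: z).
    rewrite [(a +i* b)%C]complexE /= ['i%C * _]mulrC scalerDl gD gZ.
    by rewrite -scalerA gZ.
  have ii (z : X) : 'i%C *: ('i%C *: z) = - z.
    by rewrite scalerA -expr2 sqr_i scaleN1r.
  have ci (c : R[i]) (z : X) : 'i%C *: (c *: z) = c *: ('i%C *: z).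
    by rewrite !scalerA mulrC.
  rewrite scalerDr ci !gD !gc ii gN.
  apply/eqP; rewrite eq_complex /=; apply/andP; split; apply/eqP; ring.
(* The triangle inequality gives twice the bound of [g]; only boundedness of the extension is
   claimed. *)
- exists (m + m)%:C%C => x.
  have -> : (g x +i* - g ('i%C *: x))%C =
      (g x)%:C%C - 'i%C * (g ('i%C *: x))%:C%C :> R[i].
    by rewrite [LHS]complexE /= rmorphN mulrN.
  rewrite (le_trans (ler_normB _ _))// normrM i1 mul1r NE -CM mulrDl CD.
  have normC (r : R) : `|r%:C%C| = `|r|%:C%C :> R[i].
    by rewrite normc_def /= expr0n addr0 sqrtr_sqr.
  by rewrite !normC lerD// lecR// -(Ni x).
- move=> y; have gfE (z : subspace_type Y) : g (val z) = complex.Re (f z).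
    exact: gf.
  have -> : 'i%C *: val y = val ('i%C *: y) by rewrite linearZ.
  have fZ := lf 'i%C y 0; have f0 := lf (-1) 0 0.
  move: f0; rewrite scaler0 addr0 mulN1r addNr => f0.
  move: fZ; rewrite f0 !addr0 !gfE => ->.
  by case: (f y) => a b /=; rewrite mul0r mul1r sub0r opprK.
Qed.

(** * Real and complex scalars *)

Lemma closed_norm_le (K : numFieldType) (V : normedModType K) (r : K) :
  closed [set x : V | `|x| <= r].
Proof.
move=> x clx; rewrite /mkset.
have near e : 0 < e -> exists2 y : V, `|y| <= r & `|x - y| < e.
  by move=> /(nbhsx_ballx x)/clx[y [yr]]; rewrite -ball_normE; exists y.
(* The order of [K] may be partial. A point of the set, present because [x] is adherent to it, makes
   [r] comparable with a norm and therefore real. *)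
have [y0 y0r _] := near 1 ltr01.
have rr : r \is Num.real by rewrite -(ler_real y0r) normr_real.
rewrite real_leNgt ?normr_real//; apply/negP; rewrite -subr_gt0 => /near[y yr].
rewrite real_ltNge ?realB ?normr_real// => /negP; apply.
by rewrite lerBlDr -[in leLHS](subrK y x) (le_trans (ler_normD _ _))// lerD2l.
Qed.

Lemma closed_norm_ge (K : numFieldType) (V : normedModType K) (r : K) :
  r \is Num.real -> closed [set x : V | r <= `|x|].
Proof.
move=> rr x clx; rewrite /mkset.
rewrite real_leNgt ?normr_real//; apply/negP; rewrite -subr_gt0.
move=> /(nbhsx_ballx x)/clx[y [/= yr]]; rewrite -ball_normE /=.
rewrite real_ltNge ?realB ?normr_real// => /negP; apply.
rewrite lerBlDr (le_trans yr)// -[in leLHS](subrK x y).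
by rewrite (le_trans (ler_normD _ _))// lerD2r distrC.
Qed.

Section complex_scalars.
Context (R : realType).

Lemma normC_le (a b : R) : `|(a +i* b)%C| <= `|a%:C%C| + `|b%:C%C| :> R[i].
Proof.
rewrite [(a +i* b)%C]complexE /= (le_trans (ler_normD _ _))// lerD2l normrM.
by rewrite [ `|'i%C|]normc_def /= expr0n expr1n /= add0r sqrtr1 mul1r.
Qed.

Lemma normC_real (a : R) : `|a%:C%C| = `|a|%:C%C :> R[i].
Proof. by rewrite normc_def /= expr0n addr0 sqrtr_sqr. Qed.

Lemma normC_ge_Re (z : R[i]) : `|complex.Re z|%:C%C <= `|z|.
Proof.
by rewrite normc_def lecR -sqrtr_sqr ler_wsqrtr// lerDl sqr_ge0.
Qed.

Lemma normC_ge_Im (z : R[i]) : `|complex.Im z|%:C%C <= `|z|.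
Proof.
by rewrite normc_def lecR -sqrtr_sqr ler_wsqrtr// lerDr sqr_ge0.
Qed.

Lemma complex_posP (e : R[i]) : 0 < e -> exists2 r : R, 0 < r & e = r%:C%C.
Proof.
move=> e0; exists (complex.Re e); last by rewrite RRe_real// gtr0_real.
by rewrite -ltcR RRe_real// gtr0_real.
Qed.

Local Notation C := (R[i] : numFieldType).

Lemma continuous_Re : continuous (@complex.Re R : C -> R).
Proof.
move=> z; apply/(@cvgrPdist_lt _ R _ (nbhs (z : C))) => e e0.
have e0C : (0 : R[i]) < e%:C%C by rewrite ltcR.
near=> w.
have zw : `|z - w| < e%:C%C.
  by near: w; have := nbhsx_ballx (z : C) e%:C%C e0C; rewrite -ball_normE.
rewrite -ltcR (le_lt_trans _ zw)//.
by rewrite (le_trans _ (normC_ge_Re _))//; rewrite raddfB.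
Unshelve. all: by end_near. Qed.

(** The disk is closed and lies in the continuous image of a compact square; it is empty unless [r]
    is nonnegative. *)
Lemma compact_complex_disk (r : C) : compact [set z : C | `|z| <= r].
Proof.
have [r0|nr0] := pselect (0 <= r); last first.
  have -> : [set z : C | `|z| <= r] = set0.
    apply/seteqP; split=> z //= zr; apply: nr0; exact: le_trans zr.
  exact: compact0.
pose s := complex.Re r.
have rE : r = s%:C%C by rewrite RRe_real// ger0_real.
pose h (ab : R * R) : C := (ab.1 +i* ab.2)%C.
have hc : continuous h.
  move=> [a b]; apply/cvgrPdist_lt => e /complex_posP[d d0 ->].
  have d20 : 0 < d / 2 by rewrite divr_gt0.
  exists (ball a (d / 2), ball b (d / 2)); first by split; exact: nbhsx_ballx.
  move=> [a' b'] [/=]; rewrite -!ball_normE /= => aa' bb'.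
  rewrite /h /= (le_lt_trans (normC_le _ _))//.
  by rewrite !normC_real -rmorphD ltcR [d]splitr ltrD.
have cs : compact (`[- s, s] `*` `[- s, s])%classic.
  by apply: compact_setX; exact: segment_compact.
have ch : compact (h @` (`[- s, s] `*` `[- s, s])%classic).
  by apply: continuous_compact => //; exact: continuous_subspaceT.
apply: (subclosed_compact _ ch); first exact: closed_norm_le.
move=> [a b] /= zr; exists (a, b) => //.
by split; rewrite /= in_itv /= -ler_norml -lecR -rE (le_trans _ zr)//;
  [exact: (normC_ge_Re (a +i* b)%C)|exact: (normC_ge_Im (a +i* b)%C)].
Qed.

Lemma complex_separable : exists2 D : set C, countable D &
  forall t e, 0 < e -> exists2 d, D d & `|d - t| < e.
Proof.
exists (range (fun pq : rat * rat => (ratr pq.1 +i* ratr pq.2)%C)).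
  by apply: sub_countable (card_image_le _ _) _; exact: countableP.
move=> [a b] _ /complex_posP[e e0 ->].
have dq (c : R) : exists q : rat, `|ratr q - c| < e / 2.
  have e20 : 0 < e / 2 by rewrite divr_gt0.
  have [|x [+ [q _ qx]]] := @dense_rat R (ball c (e / 2)) _ (ball_open _ _).
    by exists c; exact: ballxx.
  by rewrite -ball_normE /= distrC -qx => ?; exists q.
have [p pa] := dq a; have [q qb] := dq b.
exists (ratr p +i* ratr q)%C; first by exists (p, q).
have -> : (ratr p +i* ratr q - (a +i* b))%C =
  ((ratr p - a) +i* (ratr q - b))%C by [].
rewrite (le_lt_trans (normC_le _ _))// !normC_real -rmorphD ltcR.
by rewrite [e]splitr ltrD.
Qed.

End complex_scalars.

Section scalars.
Context (R : realType) (K : numFieldType)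
  (hK : K = R :> numFieldType \/ K = R[i] :> numFieldType).

Lemma compact_scalar_disk (r : K) : compact [set t : K | `|t| <= r].
Proof.
case: hK => e; subst K; last exact: compact_complex_disk.
have -> : [set t : R | `|t| <= r] = `[- r, r]%classic.
  by apply/seteqP; split=> t; rewrite /= in_itv /= ler_norml.
exact: segment_compact.
Qed.

Lemma scalar_separable : exists2 D : set K, countable D &
  forall t e, 0 < e -> exists2 d, D d & `|d - t| < e.
Proof.
case: hK => e; subst K; last exact: complex_separable.
exists (range ratr).
  by apply: sub_countable (card_image_le _ _) _; exact: countableP.
move=> t e e0.
have [|x [+ [q _ qx]]] := @dense_rat R (ball t e) _ (ball_open _ _).
  by exists t; exact: ballxx.
by rewrite -ball_normE /= distrC -qx => ?; exists (ratr q) => //; exists q.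
Qed.

Lemma scalar_archi (e : K) : 0 < e -> exists n, n.+1%:R^-1 < e.
Proof.
have archiR (r : R) : 0 < r -> exists n, n.+1%:R^-1 < r.
  move=> r0.
  have [n _ /(_ n (leqnn n)) nr] := near_infty_natSinv_lt (PosNum r0).
  by exists n.
case: hK e => e; subst K; first exact: archiR.
move=> _ /complex_posP[r r0 ->]; have [n nr] := archiR r r0; exists n.
have -> : n.+1%:R^-1 = (n.+1%:R^-1)%:C%C :> R[i].
  by rewrite fmorphV rmorph_nat.
by rewrite ltcR.
Qed.

(** The extreme value theorem concerns real functions, while norms take values in [K]; [re] carries
    them to [R] and reflects their order. *)
Lemma scalar_real_part : exists2 re : K -> R, continuous re &
  forall a b, a \is Num.real -> b \is Num.real -> re a <= re b -> a <= b.
Proof.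
case: hK => e; subst K.
  by exists id => // x; exact: cvg_id.
exists (@complex.Re R); first exact: continuous_Re.
by move=> a b /RRe_real<- /RRe_real<- /=; rewrite lecR.
Qed.

Lemma scalar_extension (X : normedModType K) (Y : submodClosed X)
    (f : subspace_type Y -> K) (M : K) :
  0 <= M -> scalar f -> (forall y, `|f y| <= M * `|y|) ->
  exists F : X -> K, [/\ scalar F, exists M', forall x, `|F x| <= M' * `|x| &
    forall y, F (val y) = f y].
Proof.
case: hK X Y f M => e; subst K => X Y f M M0 lf fM.
- exact: scalar_extension_real lf fM.
- exact: scalar_extension_complex M0 lf fM.
Qed.

(** The torus is compact and the norm continuous. Existence matters: in [super_ADP] a point [y]
    without a maximum would contribute nothing to the supremum. *)
Lemma norm_torus_max (X : normedModType K) (x y : X) :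
  exists m, is_max [set `|x + t *: y| | t in @torus K] m.
Proof.
have [re rec rele] := scalar_real_part.
have ctorus : compact (@torus K).
  apply: (subclosed_compact _ (@compact_scalar_disk 1)); last first.
    by move=> t /= ->.
  have -> : @torus K = [set t : K | `|t| <= 1] `&` [set t : K | 1 <= `|t|].
    apply/seteqP; split=> t; rewrite /torus /= ?[in X in X -> _]eq_le.
      by move=> ->.
    by move=> [t1 t1']; apply/le_anti; rewrite t1 t1'.
  by apply: closedI; [exact: closed_norm_le|exact: closed_norm_ge].
have [||c /set_mem ct cmax] :=
    @compact_EVT_max K R (fun t => re `|x + t *: y|) _ _ ctorus.
- by exists 1; rewrite /torus /= normr1.
- apply: continuous_subspaceT => t.
  apply: (@continuous_comp _ _ _ (fun t : K => `|x + t *: y|) re);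
    last exact: rec.
  apply: (@continuous_comp _ _ _ (fun t : K => x + t *: y) Num.norm);
    last exact: norm_continuous.
  apply: (@cvgD K X _ (nbhs t)); first exact: cvg_cst.
  by apply: (@cvgZr_tmp K X _ _ _ id); exact: cvg_id.
exists `|x + c *: y|; split; first by exists c.
move=> _ [t tt <-]; apply: rele; rewrite ?normr_real//.
exact/cmax/mem_set.
Qed.

End scalars.

(** * The weak topology *)

Section weak_adherence.
Context (K : numFieldType) (X : normedModType K).

(** Functionals are plain functions here, so that [n]-tuples of them are points of a power of [K],
    where Tychonoff's theorem applies. *)
Definition dual_ball : set (X -> K) :=
  [set f | scalar f /\ forall x, `|f x| <= `|x|].

(** Membership in the weak closure, tested with functionals of norm at most one;
    [weakly_adherent_bounded] recovers the others by scaling. *)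
Definition weakly_adherent (A : set X) (y : X) : Prop :=
  forall n (f : 'I_n -> X -> K) e, (forall i, dual_ball (f i)) -> 0 < e ->
    exists2 a, A a & forall i, `|f i (a - y)| < e.

Hypothesis compact_disk : forall r : K, compact [set t : K | `|t| <= r].

Lemma eval_continuous n (ix : 'I_n * X) :
  continuous (fun phi : {ptws ('I_n * X) -> K} => phi ix).
Proof. exact: (@proj_continuous _ (fun=> K) ix). Qed.

(* Banach-Alaoglu *)
Lemma compact_dual_ball n : compact
  [set phi : {ptws ('I_n * X) -> K} |
    forall i, dual_ball (fun x => phi (i, x))].
Proof.
pose T := [set phi : {ptws ('I_n * X) -> K} | forall ix, `|phi ix| <= `|ix.2|].
pose L := [set phi : {ptws ('I_n * X) -> K} |
  forall i, scalar (fun x => phi (i, x))].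
have -> : [set phi : {ptws ('I_n * X) -> K} |
    forall i, dual_ball (fun x => phi (i, x))] = T `&` L.
  apply/seteqP; split=> phi /=.
    move=> H; split=> [[i x]|i]; first exact: (H i).2.
    exact: (H i).1.
  by move=> [Tphi Lphi] i; split=> // x; exact: (Tphi (i, x)).
apply: compact_closedI.
  exact: (@tychonoff _ (fun=> K) (fun ix => [set t : K | `|t| <= `|ix.2|])).
pose G (q : 'I_n * K * X * X) (phi : {ptws ('I_n * X) -> K}) :=
  let: (i, r, x, y) := q in phi (i, r *: x + y) - (r * phi (i, x) + phi (i, y)).
have -> : L = \bigcap_(q in setT) (G q @^-1` [set t | `|t| <= 0]).
  apply/seteqP; split=> phi /=.
    by move=> H [[[i r] x] y] _ /=; rewrite H subrr normr0.
  move=> H i r x y; apply/eqP; rewrite -subr_eq0 -normr_le0.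
  exact: (H (i, r, x, y)).
apply: closed_bigI => -[[[i r] x] y] _; apply: closed_comp; last first.
  exact: closed_norm_le.
move=> phi _; apply: (@cvgB K K _ (nbhs phi)); first exact: eval_continuous.
apply: (@cvgD K K _ (nbhs phi)); last exact: eval_continuous.
apply: (@cvgM K _ (nbhs phi)); first exact: cvg_cst.
exact: eval_continuous.
Qed.

(** For [a] in [A], the tuples of functionals that nearly agree at [a] and [y] form an open set; by
    adherence these sets cover the compact power of the dual ball. The indices of a finite subcover
    form [C], which thus serves all tuples at once. *)
Lemma finite_weak_approximation (A : set X) (y : X) n (e : K) :
  weakly_adherent A y -> 0 < e -> exists C : set X,
    [/\ countable C, C `<=` A &
      forall f : 'I_n -> X -> K, (forall i, dual_ball (f i)) ->
        exists2 a, C a & forall i, `|f i (a - y)| < e].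
Proof.
move=> Ay e0.
pose B := [set phi : {ptws ('I_n * X) -> K} |
  forall i, dual_ball (fun x => phi (i, x))].
pose U (a : X) := [set phi : {ptws ('I_n * X) -> K} |
  forall i, `|phi (i, a) - phi (i, y)| < e].
have fB (f : X -> K) a : dual_ball f -> f (a - y) = f a - f y.
  by move=> [lf _]; rewrite -scaleN1r addrC lf mulN1r addrC.
have cB := @compact_dual_ball n.
have openU a : A a -> open (U a).
  move=> _; rewrite openE => phi Uphi.
  apply: (@filter_forall _ _ (fun i psi => `|psi (i, a) - psi (i, y)| < e)
    (nbhs phi)) => i.
  have ei : 0 < e - `|phi (i, a) - phi (i, y)| by rewrite subr_gt0.
  have cont : (fun psi : {ptws ('I_n * X) -> K} => psi (i, a) - psi (i, y))
      @ nbhs phi --> phi (i, a) - phi (i, y).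
    by apply: (@cvgB K K _ (nbhs phi)); exact: eval_continuous.
  have /(@cvgrPdist_lt K K _ (nbhs phi))/(_ _ ei) := cont.
  apply: filterS => psi /=; rewrite ltrBrDr; apply: le_lt_trans.
  have tri (u v : K) : `|u| <= `|v - u| + `|v|.
    by rewrite distrC -[in leLHS](subrK v u) ler_normD.
  exact: tri.
have BU : B `<=` cover A U.
  move=> phi Bphi; have [a Aa fa] := Ay n (fun i x => phi (i, x)) e Bphi e0.
  by exists a => // i; rewrite -(fB _ _ (Bphi i)).
pose P : ptopologicalType :=
  HB.pack {ptws ('I_n * X) -> K}
    (isPointed.Build {ptws ('I_n * X) -> K} (fun=> 0)).
move: cB; rewrite (@compact_cover P) => /(_ X A U openU BU)[D DA BD].
exists [set` D]; split.
- exact/finite_set_countable/finite_fset.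
- by move=> a /= /DA /set_mem.
- move=> f Bf; have [//|a Da Ua] := BD (fun ix => f ix.1 ix.2).
  by exists a => // i; rewrite fB //; exact: Ua.
Qed.

(* Kaplansky: the weak topology has countable tightness. *)
Lemma countable_weak_tightness (A : set X) (y : X) :
  (forall e : K, 0 < e -> exists n, n.+1%:R^-1 < e) ->
  weakly_adherent A y ->
  exists C, [/\ countable C, C `<=` A & weakly_adherent C y].
Proof.
move=> archi Ay.
have pos m : (0 : K) < m.+1%:R^-1 by rewrite invr_gt0.
have /choice[C CP] (nm : nat * nat) :=
  @finite_weak_approximation A y nm.1 _ Ay (pos nm.2).
(* Each pair of a number [n] of functionals and a precision [1/(m+1)] has its own countable set; the
   union serves all pairs. *)
exists (\bigcup_nm C nm); split.
- by apply: bigcup_countable => [|nm _]; [exact: countableP|case: (CP nm)].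
- by apply: bigcup_sub => nm _; case: (CP nm).
- move=> n f e Bf /archi[m me]; have [_ _ /(_ f Bf)[a Ca fa]] := CP (n, m).
  exists a; first by exists (n, m).
  by move=> i; exact: lt_trans (fa i) me.
Qed.

End weak_adherence.

(** * Bounded functionals and basic neighbourhoods of the weak topology *)

Section weak_neighborhoods.
Context (K : numFieldType) (X : normedModType K).

Definition bounded_functional (f : X -> K) : Prop :=
  scalar f /\ exists M, forall x, `|f x| <= M * `|x|.

Lemma functionalB (f : X -> K) x y : scalar f -> f (x - y) = f x - f y.
Proof. by move=> lf; rewrite -scaleN1r addrC lf mulN1r addrC. Qed.

Lemma functional0 (f : X -> K) : scalar f -> f 0 = 0.
Proof. by move=> lf; rewrite -(subrr 0) functionalB// subrr. Qed.

Lemma bounded_functionalP (f : X -> K) : bounded_functional f ->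
  exists2 M, 0 < M & forall x, `|f x| <= M * `|x|.
Proof.
move=> [lf [M fM]]; exists (`|M| + 1) => [|x]; first by rewrite ltr_wpDl.
have [->|x0] := eqVneq x 0; first by rewrite functional0// !normr0 mulr0.
have x1 : 0 < `|x| by rewrite normr_gt0.
rewrite (le_trans (fM x))// ler_pM2r// (@le_trans _ _ `|M|) ?lerDl//.
(* As [x] is nonzero, [M] times a positive number bounds a norm, so [M] is nonnegative, hence
   real. *)
rewrite real_ler_norm//.
have := le_trans (normr_ge0 _) (fM x).
by rewrite pmulr_lge0// => /ger0_real.
Qed.

Lemma bounded_functional_continuous (f : X -> K) :
  bounded_functional f -> continuous f.
Proof.
move=> bf; have [M M0 fM] := bounded_functionalP bf.
move=> x; apply/(@cvgrPdist_lt K K _ (nbhs x)) => e e0; near=> y.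
rewrite -functionalB; last exact: bf.1.
rewrite (le_lt_trans (fM _))// -ltr_pdivlMl//.
near: y; have eM : 0 < M^-1 * e by rewrite mulr_gt0// invr_gt0.
by have := nbhsx_ballx x _ eM; rewrite -ball_normE.
Unshelve. all: by end_near. Qed.

Lemma dual_bounded (f : dual X) : bounded_functional (sval f).
Proof.
split; first by move=> r x y; rewrite linearP.
case: f => f /= /(_ 0)/(@cvgrPdist_lt K K _ (nbhs (0 : X)))/(_ 1 ltr01).
rewrite linear0 -nbhs_ballE => -[d /= d0 fd].
(* The functional is below 1 in modulus on the ball of radius [d], and [x] is rescaled to norm
   [d / 2] to fall inside it. *)
exists (d / 2)^-1 => x.
have [->|x0] := eqVneq x 0; first by rewrite linear0 !normr0 mulr0.
have x1 : 0 < `|x| by rewrite normr_gt0.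
have d20 : 0 < d / 2 by rewrite divr_gt0.
have : ball (0 : X) d ((d / 2 / `|x|) *: x).
  rewrite -ball_normE /= sub0r normrN normrZ ger0_norm; last first.
    by rewrite ltW// divr_gt0.
  by rewrite divfK ?gt_eqF// ltr_pdivrMr// ltr_pMr// ltr1n.
move=> /fd /=; rewrite sub0r normrN linearZ normrM ger0_norm; last first.
  by rewrite ltW// divr_gt0.
rewrite mulrAC ltr_pdivrMr// mul1r => /ltW.
by rewrite ler_pdivlMl.
Qed.

Lemma weak_continuous (f : X -> K) :
  bounded_functional f -> continuous (f : weak X -> K).
Proof.
move=> bf x.
pose fl : {scalar X} := HB.pack f (GRing.isLinear.Build K X K *%R f bf.1).
pose fd : dual X := exist _ fl (bounded_functional_continuous bf).
have /cvg_sup/(_ fd) := @cvg_id _ (nbhs (x : weak X)).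
move=> /cvg_app cf; apply: cvg_trans (cf _ f) _.
exact: initial_continuous.
Qed.

Lemma open_weak_nbhd n (f : 'I_n -> X -> K) (y : X) (e : K) :
  (forall i, bounded_functional (f i)) ->
  open ([set z | forall i, `|f i (z - y)| < e] : set (weak X)).
Proof.
move=> bf; rewrite openE => z /= zU.
apply: (@filter_forall _ _ (fun i w => `|f i (w - y)| < e)
  (nbhs (z : weak X))) => i.
have ei : 0 < e - `|f i (z - y)| by rewrite subr_gt0.
have := @weak_continuous _ (bf i) z.
move=> /(@cvgrPdist_lt K K _ (nbhs (z : weak X)))/(_ _ ei).
apply: filterS => w; rewrite -functionalB; last exact: (bf i).1.
rewrite ltrBrDr; apply: le_lt_trans.
have -> : w - y = (z - y) - (z - w).
  by rewrite opprB [RHS]addrC addrA subrK.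
rewrite (functionalB (z - y) (z - w) (bf i).1).
rewrite (le_trans (ler_normB _ _))// addrC.
exact: lexx.
Qed.

(** The sets containing a basic neighbourhood of [y] form a filter. Its convergence to [y] in a
    supremum of topologies can be checked one functional at a time, and radius 1 is enough because
    [e^-1] is absorbed in the functional. *)
Lemma weak_nbhd_basis (U : set (weak X)) (y : X) : open U -> U y ->
  exists n (f : 'I_n -> X -> K), (forall i, bounded_functional (f i)) /\
    forall z, (forall i, `|f i (z - y)| < 1) -> U z.
Proof.
pose F : set_system X := fun V =>
  exists n (f : 'I_n -> X -> K), (forall i, bounded_functional (f i)) /\
    forall z, (forall i, `|f i (z - y)| < 1) -> V z.
have FF : Filter F.
  split.
  - exists 0%N, (fun=> cst 0); split=> // i.
    split=> [r a b|]; first by rewrite mulr0 addr0.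
    by exists 0 => x; rewrite normr0 mul0r.
  - move=> V1 V2 [n1 [f1 [b1 fV1]]] [n2 [f2 [b2 fV2]]].
    exists (n1 + n2)%N, (fun i =>
      match fintype.split i with inl j => f1 j | inr j => f2 j end).
    split=> [i|z fz]; first by case: fintype.split.
    split; [apply: fV1 => j|apply: fV2 => j].
      by have := fz (lshift n2 j); rewrite (unsplitK (inl j)).
    by have := fz (rshift n1 j); rewrite (unsplitK (inr j)).
  - by move=> V1 V2 V12 [n [f [bf fV]]]; exists n, f; split=> // z /fV /V12.
suff : F --> (y : weak X).
  by move=> FU oU Uy; apply: FU; exact: open_nbhs_nbhs.
apply/cvg_sup => d A [B [[C oC <-] Cy] BA].
have := oC; rewrite openE => /(_ _ Cy).
rewrite /interior -nbhs_ballE => -[e e0 eC].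
have bd := dual_bounded d.
exists 1%N, (fun _ x => e^-1 * sval d x); split=> [_|z /(_ ord0)].
  have [M M0 dM] := bounded_functionalP bd; split.
    by move=> r a b; rewrite linearP mulrDr /= mulrCA.
  exists (e^-1 * M) => x; rewrite normrM -mulrA gtr0_norm ?invr_gt0//.
  by rewrite ler_wpM2l// invr_ge0 ltW.
rewrite normrM gtr0_norm ?invr_gt0// ltr_pdivrMl// mulr1 => dz.
apply: BA; apply: eC; rewrite -ball_normE /= distrC.
by rewrite -linearB.
Qed.

(** Dividing all [f i] by a common bound [S] of their norms puts them in [dual_ball]; the precision
    is divided by [S] as well. *)
Lemma weakly_adherent_bounded (A : set X) (y : X) n (f : 'I_n -> X -> K) e :
  weakly_adherent A y -> (forall i, bounded_functional (f i)) -> 0 < e ->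
  exists2 a, A a & forall i, `|f i (a - y)| < e.
Proof.
move=> Ay bf e0.
have /choice[M MP] i : exists M, 0 < M /\ forall x, `|f i x| <= M * `|x|.
  by have [M M0 fM] := bounded_functionalP (bf i); exists M.
(* A sum avoids maxima in a partial order; the summand 1 keeps [S] positive when [n = 0]. *)
pose S := 1 + \sum_i M i.
have S0 : 0 < S.
  by rewrite ltr_pwDl// sumr_ge0// => i _; rewrite ltW//; case: (MP i).
have MS i : M i <= S.
  rewrite /S (bigD1 i)//= addrCA lerDl addr_ge0// sumr_ge0// => j _.
  by rewrite ltW//; case: (MP j).
have [i||a Aa fa] := Ay n (fun i x => S^-1 * f i x) (S^-1 * e).
- split=> [r x z|x]; first by rewrite (bf i).1 mulrDr mulrCA.
  rewrite normrM gtr0_norm ?invr_gt0// ler_pdivrMl//.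
  by rewrite (le_trans ((MP i).2 x))// ler_wpM2r.
- by rewrite mulr_gt0// invr_gt0.
exists a => // i; have := fa i.
by rewrite normrM gtr0_norm ?invr_gt0// ltr_pM2l// invr_gt0.
Qed.

End weak_neighborhoods.

(** * Separable subspaces *)

Lemma countable_setU T (A B : set T) :
  countable A -> countable B -> countable (A `|` B).
Proof.
move=> cA cB.
have -> : A `|` B = \bigcup_(b in [set: bool]) (if b then A else B).
  apply/seteqP; split=> [x [Ax|Bx]|x [[] _ ?]].
  - by exists true.
  - by exists false.
  - by left.
  - by right.
by apply: bigcup_countable => // -[].
Qed.

(** [S] is the union of the increasing stages [A n]: two of its elements lie in a common stage, and
    [F] sends them into the next. *)
Lemma countable_closure T (D : set T) (F : T -> T -> set T) :
  countable D -> (forall x y, countable (F x y)) ->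
  exists S, [/\ countable S, D `<=` S &
    forall x y, S x -> S y -> F x y `<=` S].
Proof.
move=> cD cF.
pose step A := A `|` \bigcup_(xy in A `*` A) F xy.1 xy.2.
pose A n := iter n step D.
have A_mono m n : (m <= n)%N -> A m `<=` A n.
  move=> /subnK <-; elim: (n - m)%N => [//|k IH].
  by apply: subset_trans IH _; left.
exists (\bigcup_n A n); split.
- apply: bigcup_countable => // n _; elim: n => [//|n IH].
  apply: countable_setU => //; apply: bigcup_countable => //.
  exact: countableX.
- by move=> x Dx; exists 0%N.
- move=> x y [m _ Amx] [n _ Any] z Fz; exists (maxn m n).+1 => //; right.
  exists (x, y) => //; split => /=.
  + exact: A_mono (leq_maxl m n) _ Amx.
  + exact: A_mono (leq_maxr m n) _ Any.
Qed.

Section closures.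
Context (K : numFieldType) (X : normedModType K).

Lemma closure_normP (S : set X) x :
  closure S x <-> forall e : K, 0 < e -> exists2 s, S s & `|s - x| < e.
Proof.
split=> [Sx e /(nbhsx_ballx x)/Sx[s [Ss]]|H B].
  by rewrite -ball_normE /= distrC; exists s.
rewrite -nbhs_ballE => -[e e0 eB]; have [s Ss sx] := H e e0.
by exists s; split=> //; apply: eB; rewrite -ball_normE /= distrC.
Qed.

(** Stability under a dense set [D] of scalars is enough, as scalar multiplication is continuous; so
    the closure of a countable [S] can be a linear subspace. *)
Lemma closure_submodule (D : set K) (S : set X) (x0 : X) :
  (forall t e, 0 < e -> exists2 d, D d & `|d - t| < e) -> S x0 ->
  (forall x y, S x -> S y -> S (x + y)) ->
  (forall d x, D d -> S x -> S (d *: x)) ->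
  exists W : submodClosed X, forall x, (x \in W) <-> closure S x.
Proof.
move=> denseD Sx0 SD SZ.
have clD x y : closure S x -> closure S y -> closure S (x + y).
  move=> /closure_normP Sx /closure_normP Sy; apply/closure_normP => e e0.
  have e20 : 0 < e / 2 by rewrite divr_gt0.
  have [s Ss sx] := Sx _ e20; have [t St ty] := Sy _ e20.
  exists (s + t); first exact: SD.
  by rewrite opprD addrACA (le_lt_trans (ler_normD _ _))// [e]splitr ltrD.
have clZ c x : closure S x -> closure S (c *: x).
  move=> /closure_normP Sx; apply/closure_normP => e e0.
  have c1 : 0 < `|c| + 1 by rewrite ltr_wpDl.
  (* The error is [(d - c) s + c (s - x)]: [s] is chosen first, then [d] with a precision depending
     on [|s|]. Adding 1 avoids division by zero. *)
  have [|s Ss sx] := Sx (e / 2 / (`|c| + 1)); first by rewrite !divr_gt0.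
  have s1 : 0 < `|s| + 1 by rewrite ltr_wpDl.
  have [|d Dd dc] := denseD c (e / 2 / (`|s| + 1)); first by rewrite !divr_gt0.
  exists (d *: s); first exact: SZ.
  have -> : d *: s - c *: x = (d - c) *: s + c *: (s - x).
    by rewrite scalerBl scalerBr addrA subrK.
  rewrite (le_lt_trans (ler_normD _ _))// [e]splitr !normrZ ltrD//.
    move: dc; rewrite ltr_pdivlMr//; apply: le_lt_trans.
    by rewrite ler_wpM2l// lerDl.
  move: sx; rewrite ltr_pdivlMr// mulrC; apply: le_lt_trans.
  by rewrite ler_wpM2r// lerDl.
have cl0 : closure S 0.
  by rewrite -(scale0r x0); apply/clZ/subset_closure.
pose P : {pred X} := [pred x | `[< closure S x >]].
have Psub : GRing.submod_closed P.
  split=> [|a x y]; first exact/asboolP.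
  by move=> /asboolP Px /asboolP Py; apply/asboolP/clD => //; exact: clZ.
pose W : submodClosed X := HB.pack P (GRing.isSubmodClosed.Build K X P Psub).
by exists W => x; split=> /asboolP.
Qed.

End closures.

(** * Passage of the super ADP to the closure of a suitable set *)

Section super_ADP_transfer.
Context (K : numFieldType) (X : normedModType K).

Definition normalize (x : X) : X := `|x|^-1 *: x.

Lemma normalize_sphere x : x != 0 -> `|normalize x| = 1.
Proof.
move=> x0; rewrite normrZ gtr0_norm ?invr_gt0 ?normr_gt0//.
by rewrite mulVf// normr_eq0.
Qed.

(** The distance from [normalize x] to [x] is [|1 - |x||], which is at most [|u - x|] because
    [|u| = 1]. *)
Lemma normalize_dist (x u : X) : x != 0 -> `|u| = 1 ->
  `|normalize x - u| <= `|x - u| + `|x - u|.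
Proof.
move=> x0 u1; have -> : normalize x - u = (normalize x - x) + (x - u).
  by rewrite addrA subrK.
rewrite (le_trans (ler_normD _ _))// lerD2r.
have -> : normalize x - x = (`|x|^-1 - 1) *: x by rewrite scalerBl scale1r.
rewrite normrZ -[X in _ * X]normr_id -normrM mulrBl mulVf ?normr_eq0// mul1r.
by rewrite -u1 distrC; exact: ler_dist_dist.
Qed.

Definition almost_diametral (u : X) (k : nat) : set X :=
  [set z | `|z| <= 1 /\
    exists2 t : K, `|t| = 1 & 2 - k.+1%:R^-1 < `|u + t *: z|].

(** Otherwise a basic weak neighbourhood of [v] misses the set, and [2 - 1/(k+1)] bounds all maxima
    over its trace on the unit ball. That trace meets the sphere at [v], so the super ADP makes
    their supremum 2. *)
Lemma super_ADP_adherent (u v : X) k : super_ADP X -> `|u| = 1 -> `|v| = 1 ->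
  weakly_adherent (almost_diametral u k) v.
Proof.
move=> adpX u1 v1 n f e bf e0.
have bdf i : bounded_functional (f i).
  by have [lf fle] := bf i; split=> //; exists 1 => x; rewrite mul1r.
pose U : set (weak X) := [set z | forall i, `|f i (z - v)| < e].
pose V : set X := U `&` [set x | `|x| <= 1].
have Vv : V v.
  split; last by rewrite /= v1.
  by move=> i; rewrite subrr functional0 ?normr0//; case: (bdf i).
have [||||_ lbV] := adpX u _ V.
- exact: u1.
- by exists v.
- by exists U => //; exact: open_weak_nbhd.
- by exists v.
apply: contrapT => nA.
have k0 : (0 : K) < k.+1%:R^-1 by rewrite invr_gt0.
have : (2 : K) <= 2 - k.+1%:R^-1.
  apply: lbV => m [y [Uy y1] [[t t1 <-] _]].
  rewrite real_leNgt ?normr_real ?realB ?gtr0_real//.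
  by apply/negP => lt; apply: nA; exists y => //; split=> //; exists t.
by rewrite lerBrDr gerDl lt_geF.
Qed.

(* The functionals of W extend to X, so weak adherence in X controls the weak
   topology of W. *)
Lemma super_ADP_subspace (W : submodClosed X) (S : set X) :
  (forall e : K, 0 < e -> exists n, n.+1%:R^-1 < e) ->
  (forall x y : X, exists m, is_max [set `|x + t *: y| | t in @torus K] m) ->
  (forall f : subspace_type W -> K, bounded_functional f ->
     exists2 F : X -> K, bounded_functional F & forall y, F (val y) = f y) ->
  (forall x, (x \in W) <-> closure S x) ->
  (forall x y k, S x -> S y -> x != 0 -> y != 0 ->
     weakly_adherent (almost_diametral (normalize x) k `&` S) (normalize y)) ->
  super_ADP (subspace_type W).
Proof.
move=> archi maxT ext WS adh u u1 V _ [U oU VE] [v [Vv v1]].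
have near (w : subspace_type W) (e : K) : `|w| = 1 -> 0 < e ->
    exists x, [/\ S x, x != 0 & `|normalize x - val w| < e].
  move=> w1 e0.
  have /WS/closure_normP clw : val w \in W := valP w.
  (* One formula in place of a minimum: [d] is below 1, so that [s] is nonzero, and below [e / 2],
     which absorbs the doubling in [normalize_dist]. *)
  pose d := (e^-1 + e^-1 + 2)^-1.
  have ei : 0 < e^-1 by rewrite invr_gt0.
  have d0 : 0 < d by rewrite invr_gt0 !addr_gt0.
  have [s Ss sw] := clw d d0.
  have w1' : `|val w| = 1 by exact: w1.
  have s0 : s != 0.
    apply/eqP => s0; move: sw; rewrite s0 sub0r normrN w1' -ltf_pV2 ?posrE//.
    rewrite /d invrK invr1 le_gtF// (@le_trans _ _ 2)//; first by rewrite ler1n.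
    by rewrite lerDr ltW// addr_gt0.
  exists s; split=> //; apply: (le_lt_trans (normalize_dist s0 w1')).
  rewrite (lt_le_trans (ltrD sw sw))// -mulr2n -mulr_natl.
  rewrite ler_pdivrMr ?addr_gt0// mulrDr [e * (_ + _)]mulrDr mulfV ?gt_eqF//.
  by rewrite lerDl mulr_ge0// ltW.
have W_max (x y : subspace_type W) :
  exists m, is_max [set `|x + t *: y| | t in @torus K] m.
  exact: (maxT (val x) (val y)).
split=> [m [y Vy [[t t1 <-] _]]|b ubb].
  have y1 : `|y| <= 1 by move: Vy; rewrite VE => -[].
  rewrite (le_trans (ler_normD _ _))// normrZ t1 mul1r u1 -[2]/(1 + 1).
  by rewrite lerD2l.
(* The maximum at [v] is nonnegative and at most [b], which makes [b] real and thus comparable with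
   2. *)
have [m0 m0max] := W_max u v.
have m0b : m0 <= b by apply: ubb; exists v.
have b0 : 0 <= b.
  by apply: le_trans m0b; case: m0max => -[t _ <-] _; exact: normr_ge0.
rewrite real_leNgt ?ger0_real//; apply/negP; rewrite -subr_gt0 => b2.
(* Half of the gap [2 - b] is for [1/(k+1)], the other half for replacing [u] by the normalized
   element [x] of [S]. *)
have b20 : 0 < (2 - b) / 2 by rewrite divr_gt0.
have [k kb] := archi _ b20.
have [x [Sx x0 xu]] := near u _ u1 b20.
have Uv : U v by move: Vv; rewrite VE => -[].
have [n [f [bf fU]]] := weak_nbhd_basis oU Uv.
have /choice[F FP] i : exists F : X -> K,
    bounded_functional F /\ forall y, F (val y) = f i y.
  by have [F bF Ff] := ext _ (bf i); exists F.
(* The basic neighbourhood of [v] has radius 1: half is spent on moving from [v] to [normalize y],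
   half on the adherence to [normalize y]. *)
have half0 : (0 : K) < 1 / 2 by rewrite divr_gt0.
have /choice[M MP] i : exists M, 0 < M /\ forall x, `|F i x| <= M * `|x|.
  by have [M M0 FM] := bounded_functionalP (FP i).1; exists M.
pose L := 2 + \sum_i M i.
have L0 : 0 < L.
  by rewrite ltr_pwDl// sumr_ge0// => i _; rewrite ltW//; case: (MP i).
have ML i : M i <= L.
  rewrite /L (bigD1 i)//= addrCA lerDl addr_ge0// sumr_ge0// => j _.
  by rewrite ltW//; case: (MP j).
have L2 : 0 < L^-1 * (1 / 2) by rewrite mulr_gt0// invr_gt0.
have [y [Sy y0 yv]] := near v _ v1 L2.
have [z [[z1 [t t1 zt]] Sz] Fz] := weakly_adherent_bounded
  (adh x y k Sx Sy x0 y0) (fun i => (FP i).1) half0.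
have Wz : z \in W by apply/WS/subset_closure.
pose w : subspace_type W := Sub z Wz.
have Vw : V w.
  rewrite VE; split; last by exact: z1.
  apply: fU => i; rewrite -(FP i).2 linearB /= [1]splitr.
  have -> : z - val v = (z - normalize y) + (normalize y - val v).
    by rewrite addrA subrK.
  have FD a b' : F i (a + b') = F i a + F i b'.
    by have := (FP i).1.1 1 a b'; rewrite scale1r mul1r.
  rewrite FD (le_lt_trans (ler_normD _ _))// ltrD//.
  rewrite (le_lt_trans ((MP i).2 _))//.
  rewrite (@le_lt_trans _ _ (L * `|normalize y - val v|)) ?ler_wpM2r//.
  by rewrite -ltr_pdivlMl.
have [m mmax] := W_max u w.
have mb : m <= b by apply: ubb; exists w.
have : `|u + t *: w| <= m by apply: mmax.2; exists t.
move=> /le_trans/(_ mb) ub.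
have {}ub : `|val u + t *: z| <= b by exact: ub.
have tri : `|normalize x + t *: z| <=
    `|val u + t *: z| + `|normalize x - val u|.
  rewrite (le_trans _ (ler_normD _ _))//.
  by rewrite [X in _ <= `|X|]addrC addrA subrK.
have := lt_le_trans zt tri.
have : `|val u + t *: z| + `|normalize x - val u| + k.+1%:R^-1 < 2.
  rewrite [2](_ : _ = b + (2 - b) / 2 + (2 - b) / 2).
    by rewrite ltrD// ler_ltD.
  by rewrite -addrA -splitr addrC subrK.
by rewrite -ltrBrDr => /lt_trans h /h; rewrite ltxx.
Qed.

End super_ADP_transfer.

Theorem corollary3p8 (R : realType) (K : numFieldType)
    (hK : K = R :> numFieldType \/ K = R[i] :> numFieldType)
    (X : completeNormedModType K) (Z : submodClosed X) :
  infinite_dimensional X -> super_ADP X -> separable (subspace_type Z) ->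
  exists W : submodClosed X,
    [/\ closed [set x | x \in W],
        (exists2 x, x \in W & x != 0),
        separable (subspace_type W),
        super_ADP (subspace_type W) &
        {subset Z <= W}].
Proof.
move=> infX adpX [D cD denseD].
(* A zero space is spanned by the empty family. The vector [x0] is put in [S] to make [W]
   nonzero. *)
have [x0 x0n0] : exists x0 : X, x0 != 0.
  apply: contrapT => X0; apply: infX; exists 0%N, (fun=> 0) => x.
  exists (fun=> 0); rewrite big_ord0; apply/eqP/negPn/negP => xn0.
  by apply: X0; exists x.
have [Q cQ denseQ] := scalar_separable hK.
have archi := scalar_archi hK.
(* The choice is made for all triples at once, with the empty set as value when one of the vectors
   is zero and has no normalization on the sphere. *)
have /choice[C CP] (q : X * X * nat) : exists C, countable C /\
    (q.1.1 != 0 -> q.1.2 != 0 ->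
      C `<=` almost_diametral (normalize q.1.1) q.2 /\
      weakly_adherent C (normalize q.1.2)).
  have [x_n0|] := eqVneq q.1.1 0; first by exists set0.
  have [y_n0|] := eqVneq q.1.2 0; first by exists set0.
  move=> yn0 xn0.
  have [C [cC CA Cy]] := countable_weak_tightness (compact_scalar_disk hK) archi
    (super_ADP_adherent q.2 adpX (normalize_sphere xn0) (normalize_sphere yn0)).
  by exists C.
pose F x y := [set x + y] `|` ([set r *: x | r in Q] `|` \bigcup_k C (x, y, k)).
have [|x y|S [cS DS SF]] :=
  @countable_closure _ ([set val z | z in D] `|` [set x0]) F.
- by apply: countable_setU => //; apply: sub_countable (card_image_le _ _) cD.
- apply: countable_setU => //; apply: countable_setU.
    exact: sub_countable (card_image_le _ _) cQ.
  by apply: bigcup_countable => // k _; case: (CP (x, y, k)).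
have Sx0 : S x0 by apply: DS; right.
have [|r x Qr Sx|W WS] := closure_submodule denseQ Sx0.
- by move=> x y Sx Sy; apply: (SF x y) => //; left.
- by apply: (SF x x) => //; right; left; exists r.
exists W; split.
- have -> : [set x | x \in W] = closure S.
    by apply/seteqP; split=> x /WS.
  exact: closed_closure.
- by exists x0 => //; apply/WS/subset_closure.
- exists [set w | S (val w)].
    have /countable_injP[f finj] := cS; apply/countable_injP.
    exists (f \o val) => a b /set_mem Sa /set_mem Sb fab.
    by apply/val_inj/finj => //; exact/mem_set.
  move=> O [w Ow]; rewrite openE => /(_ _ Ow).
  rewrite /interior -nbhs_ballE => -[e e0 eO].
  have /WS/closure_normP/(_ e e0)[s Ss sw] := valP w.
  have Ws : s \in W by apply/WS/subset_closure.
  exists (Sub s Ws); split; last exact: Ss.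
  apply: eO; rewrite -ball_normE /= distrC.
  exact: sw.
- apply: (super_ADP_subspace archi _ _ WS).
  + exact: norm_torus_max hK _.
  + move=> f bf; have [M M0 fM] := bounded_functionalP bf.
    have [G [lG bG Gf]] := scalar_extension hK (ltW M0) bf.1 fM.
    by exists G.
  (* The closure under [F] puts [C (x, y, k)] inside [S], and enlarging a set preserves weak
     adherence. *)
  + move=> x y k Sx Sy xn0 yn0; have [_ /(_ xn0 yn0)[CA Cy]] := CP (x, y, k).
    move=> n f e bf e0; have [a Ca fa] := Cy n f e bf e0.
    exists a => //; split; first exact: CA.
    by apply: (SF x y) => //; right; right; exists k.
- move=> z Zz; apply/WS/closure_normP => e e0.
  pose w : subspace_type Z := Sub z Zz.
  have [|d [bd Dd]] := denseD (ball w e) _ (ball_open _ _).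
    by exists w; exact: ballxx.
  exists (val d); first by apply: DS; left; exists d.
  by move: bd; rewrite -ball_normE /= distrC.
Qed.
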